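(* If $G$ is a permutation graph on $n$ vertices, then $t(G)\le \frac{n}{2}$.
   Context: A graph $G=(V,E)$ is a threshold graph if there exist non-negative reals $w_v$ ($v\in V$) and $t$ such that for every $U\subseteq V$, $\sum_{v\in U} w_v \le t$ if and only if $U$ is a stable (independent) set. The threshold dimension $t(G)$ of a graph $G$ is the least integer $k$ such that there are threshold graphs $T_1,\dots,T_k$ with $V(T_i)=V(G)$ for all $i$ and $E(G)=E(T_1)\cup\cdots\cup E(T_k)$. For a permutation $\Pi$ of $\{1,\dots,n\}$, the graph $G[\Pi]$ has vertex set $\{1,\dots,n\}$ and $i,j$ adjacent iff $(i-j)(\Pi^{-1}(i)-\Pi^{-1}(j))<0$; a graph is a permutation graph if it is isomorphic to $G[\Pi]$ for some permutation $\Pi$. *)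

(* Defs.v *)
From HB Require Import structures.
From mathcomp Require Import all_boot all_order all_fingroup all_algebra.
From mathcomp Require Import boolp reals.

Set Implicit Arguments.
Unset Strict Implicit.
Unset Printing Implicit Defensive.

Import Order.TTheory GRing.Theory Num.Theory.
Local Open Scope ring_scope.

Record sgraph (V : finType) := SGraph {
  adj :> rel V;
  adj_sym : symmetric adj;
  adj_irr : irreflexive adj }.

Definition stable (V : finType) (G : sgraph V) (U : {set V}) : Prop :=
  forall x y, x \in U -> y \in U -> ~~ adj G x y.

Definition threshold_graph (R : realType) (V : finType) (G : sgraph V) : Prop :=
  exists (w : V -> R) (t : R),
    [/\ forall v, 0 <= w v, 0 <= t &
        forall U : {set V}, \sum_(v in U) w v <= t <-> stable G U].

(* The case k = 0 is allowed: it holds exactly when G has no edge. *)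
Definition threshold_cover (R : realType) (V : finType) (G : sgraph V)
    (k : nat) : Prop :=
  exists T : 'I_k -> sgraph V,
    (forall i, threshold_graph R (T i)) /\
    (forall x y, adj G x y <-> exists i, adj (T i) x y).

Section Existence.
Variables (R : realType) (V : finType).

Definition edge_rel (a b : V) : rel V :=
  fun x y => (a != b) && ((x == a) && (y == b) || (x == b) && (y == a)).

Lemma edge_rel_sym a b : symmetric (edge_rel a b).
Proof.
by move=> x y; rewrite /edge_rel orbC [(x == b) && _]andbC [(x == a) && _]andbC.
Qed.

Lemma edge_rel_irr a b : irreflexive (edge_rel a b).
Proof.
move=> x; rewrite /edge_rel; case: (eqVneq a b) => //= ab.
rewrite [(x == b) && _]andbC orbb.
by case: (eqVneq x a) => //= ->; apply: negbTE.
Qed.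

Definition edge_graph a b := SGraph (edge_rel_sym a b) (edge_rel_irr a b).

Lemma edge_graph_threshold a b : a != b -> threshold_graph R (edge_graph a b).
Proof.
move=> ab; exists (fun v => ((v == a) || (v == b))%:R), 1; split.
- by move=> v; rewrite ler0n.
- exact: ler01.
move=> U; rewrite -natr_sum -[1]/(1%:R) ler_nat.
have -> : (\sum_(v in U) ((v == a) || (v == b)) = (a \in U) + (b \in U))%N.
  rewrite (eq_bigr (fun v => (v == a) + (v == b))%N); last first.
    move=> v _; case: (eqVneq v a) => [->|] /=; last by rewrite add0n.
    by rewrite (negbTE ab).
  rewrite big_split /=.
  have one c : (\sum_(v in U) (v == c) = (c \in U))%N.
    case cU: (c \in U).
      by rewrite (bigD1 c) //= eqxx big1 // => v /andP[_ /negbTE ->].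
    by rewrite big1 // => v vU; case: eqP vU => // ->; rewrite cU.
  by rewrite !one.
split.
- move=> le1 x y xU yU; apply/negP => /= /andP[_].
  by case/orP => /andP[/eqP xE /eqP yE]; subst x y; rewrite xU yU in le1.
move=> st; case aU: (a \in U); case bU: (b \in U) => //.
by have := st _ _ aU bU; rewrite /= /edge_rel ab !eqxx.
Qed.

Lemma threshold_cover_exists (G : sgraph V) :
  exists k, `[< threshold_cover R G k >].
Proof.
pose E := [set p : V * V | adj G p.1 p.2].
exists #|E|; apply/asboolP.
exists (fun i => edge_graph (enum_val i).1 (enum_val i).2); split.
  move=> i; apply: edge_graph_threshold; have := enum_valP i; rewrite inE.
  by apply: contraTneq => ->; rewrite adj_irr.
move=> x y; split.
  move=> xy; have pE : (x, y) \in E by rewrite inE.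
  exists (enum_rank_in pE (x, y)); rewrite enum_rankK_in //= /edge_rel !eqxx.
  rewrite /= andbT; apply/eqP => xE; by move: xy; rewrite xE adj_irr.
case=> i /= /andP[_]; have := enum_valP i; rewrite inE => ab.
by case/orP => /andP[/eqP -> /eqP ->] //; rewrite adj_sym.
Qed.

End Existence.

Definition threshold_dim (R : realType) (V : finType) (G : sgraph V) : nat :=
  ex_minn (threshold_cover_exists R G).

Definition isomorphic (V W : finType) (G : sgraph V) (H : sgraph W) : Prop :=
  exists2 f : V -> W, bijective f & forall x y, adj G x y = adj H (f x) (f y).

(* The vertices 1, ..., n are represented by 0, ..., n - 1; only differences
   of labels and of positions matter. *)
Definition inversion_rel (n : nat) (s : 'S_n) : rel 'I_n :=
  fun i j => (i%:Z - j%:Z) * ((s^-1%g i)%:Z - (s^-1%g j)%:Z) < 0.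

Lemma inversion_rel_sym n (s : 'S_n) : symmetric (inversion_rel s).
Proof.
by move=> i j; rewrite /inversion_rel -[i%:Z - _]opprB
  -[X in _ * X]opprB mulrNN.
Qed.

Lemma inversion_rel_irr n (s : 'S_n) : irreflexive (inversion_rel s).
Proof. by move=> i; rewrite /inversion_rel subrr mul0r ltxx. Qed.

Definition inversion_graph n (s : 'S_n) : sgraph 'I_n :=
  SGraph (inversion_rel_sym s) (inversion_rel_irr s).

Definition permutation_graph (V : finType) (G : sgraph V) : Prop :=
  exists (n : nat) (s : 'S_n), isomorphic G (inversion_graph s).

(* Main.v *)
(** Let [alpha] be the size of a largest stable set [S].  The stars centred at
    the vertices outside [S] cover all edges, so [t(G) <= n - alpha].  It also
    holds that [t(G) <= alpha]: distinct non-adjacent vertices of a permutation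
    graph are ordered by "smaller label and smaller position", whose chains are
    the stable sets, so the height function of this order splits the vertices
    into at most [alpha] cliques.  For a clique [C], the edges whose endpoint of
    smaller label lies in [C] form a split graph in which the neighbourhoods of
    the members of [C] decrease with the label; such a graph is threshold.
    Finally [min(alpha, n - alpha) <= n / 2]. *)
Require Import Defs.
From mathcomp Require Import all_boot all_order all_fingroup all_algebra.
From mathcomp Require Import boolp reals.
From mathcomp Require Import zify.

Set Implicit Arguments.
Unset Strict Implicit.
Unset Printing Implicit Defensive.

Import Order.TTheory GRing.Theory Num.Theory.
Local Open Scope ring_scope.

Lemma nested_split_threshold (R : realType) (V : finType) (T : sgraph V)
    (K : {set V}) (r : V -> nat) :
  (forall x y, x \in K -> y \in K -> x != y -> adj T x y) ->
  (forall x y, x \in K -> y \notin K -> adj T x y = (r x <= r y)%N) ->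
  (forall x y, x \notin K -> y \notin K -> ~~ adj T x y) ->
  threshold_graph R T.
Proof.
move=> TK TKI TI.
pose B := #|V|.+1; pose M := (\max_x r x)%N.
have rM x : (r x <= M)%N by apply: leq_bigmax.
have BM x : (B ^ r x <= B ^ M)%N by rewrite leq_pexp2l.
have B0 m : (0 < B ^ m)%N by rewrite expn_gt0.
(* Large enough that any two members of [K] together exceed [t], while all vertices outside [K]
   together do not. *)
pose t := (2 * B ^ M.+1)%N.
have BMt : (2 * B ^ M <= t)%N by rewrite leq_mul2l /= leq_pexp2l.
(* A member [x] of [K] leaves room [B ^ r x - 1]: enough for all outside
   vertices of smaller rank, which are fewer than [B] and weigh at most
   [B ^ (r x - 1)] each, but not for a single one of rank at least [r x]. *)
pose W x := (if x \in K then t.+1 - B ^ r x else B ^ r x)%N.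
exists (fun x => (W x)%:R), t%:R; split=> [v||U]; try exact: ler0n.
rewrite -natr_sum ler_nat; split=> [le_t x y xU yU|stU].
- apply/negP => xy.
  have nxy : y != x by apply: contraTneq xy => ->; rewrite adj_irr.
  have {}le_t : (W x + W y <= t)%N.
    apply: leq_trans le_t.
    by rewrite (bigD1 x) //= leq_add2l (bigD1 y) ?yU //= leq_addr.
  move: le_t; apply/negP; rewrite -ltnNge /W.
  have := BM x; have := BM y.
  case: (boolP (x \in K)) => xK; case: (boolP (y \in K)) => yK.
  + lia.
  + move: xy; rewrite TKI // => rxy.
    have := leq_pexp2l (isT : 0 < B)%N rxy; lia.
  + move: xy; rewrite adj_sym TKI // => rxy.
    have := leq_pexp2l (isT : 0 < B)%N rxy; lia.
  + by rewrite (negbTE (TI _ _ xK yK)) in xy.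
- case: (pickP (fun x => (x \in U) && (x \in K))) => [x /andP[xU xK]|UK].
  + rewrite (bigD1 x) //= {1}/W xK.
    suff : (\sum_(y in U | y != x) W y < B ^ r x)%N by have := BM x; lia.
    (* After multiplication by [B] each summand is at most [B ^ r x], and there are fewer than [B]
       of them; [r x = 0] needs no separate case. *)
    rewrite -(ltn_pmul2r (isT : 0 < B)%N) big_distrl /=.
    apply: (@leq_ltn_trans (\sum_(y : V) B ^ r x)%N); last first.
      by rewrite sum_nat_const mulnC ltn_pmul2l.
    rewrite big_mkcond /=; apply: leq_sum => y _.
    case: ifP => // /andP[yU yx]; rewrite /W.
    have nadj := stU _ _ xU yU.
    case: (boolP (y \in K)) => yK.
      by rewrite TK // eq_sym in nadj.
    move: nadj; rewrite TKI // -ltnNge => ryx.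
    by rewrite -expnSr leq_pexp2l.
  + apply: (@leq_trans (\sum_(y : V) B ^ M)%N).
      rewrite big_mkcond /=; apply: leq_sum => y _.
      case: ifP => // yU; rewrite /W; move: (UK y); rewrite yU /= => ->.
      exact: BM.
    rewrite sum_nat_const /t expnS mulnA leq_mul2r; apply/orP; right.
    exact: leq_trans (leqnSn _) (leq_pmull _ _).
Qed.

Lemma threshold_dim_le (R : realType) (V : finType) (G : sgraph V) k :
  threshold_cover R G k -> (threshold_dim R G <= k)%N.
Proof.
move=> Gk; rewrite /threshold_dim; case: ex_minnP => m _; apply.
exact/asboolP.
Qed.

Section SubGraphs.
Variables (V : finType) (G : sgraph V).

Definition star_rel (v : V) : rel V :=
  fun x y => adj G x y && ((x == v) || (y == v)).

Lemma star_rel_sym v : symmetric (star_rel v).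
Proof. by move=> x y; rewrite /star_rel adj_sym orbC. Qed.

Lemma star_rel_irr v : irreflexive (star_rel v).
Proof. by move=> x; rewrite /star_rel adj_irr. Qed.

Definition star v := SGraph (star_rel_sym v) (star_rel_irr v).

(** Here [K] is [[set v]]; [v] and its neighbours get rank 1, all other vertices rank 0. *)
Lemma star_threshold (R : realType) v : threshold_graph R (star v).
Proof.
apply: (@nested_split_threshold _ _ _ [set v]
          (fun x => ((x == v) || adj G v x) : nat)).
- by move=> x y /set1P-> /set1P->; rewrite eqxx.
- move=> x y /set1P->; rewrite inE /= /star_rel eqxx /= => /negbTE->.
  by rewrite andbT; case: (adj G v y).
- by move=> x y; rewrite !inE /= /star_rel => /negbTE-> /negbTE->; rewrite andbF.
Qed.

Lemma threshold_dim_stable (R : realType) (U : {set V}) :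
  stable G U -> (threshold_dim R G <= #|V| - #|U|)%N.
Proof.
move=> stU; rewrite -(cardsC U) addKn; apply: threshold_dim_le.
exists (fun i => star (enum_val i)); split=> [i|x y]; first exact: star_threshold.
split=> [xy|[i /andP[]//]].
have ex z : z \in ~: U -> (x == z) || (y == z) ->
    exists i : 'I_#|~: U|, star (enum_val i) x y.
  by move=> zU xyz; exists (enum_rank_in zU z);
    rewrite enum_rankK_in //= /star_rel xy.
have [xU|xU] := boolP (x \in U); last by apply: (ex x); rewrite ?inE ?eqxx.
have [yU|yU] := boolP (y \in U); last by apply: (ex y); rewrite ?inE ?eqxx ?orbT.
by have := stU _ _ xU yU; rewrite xy.
Qed.

(** [a] plays the role of the label and [b] of the position; edges are inversions. *)
Variables (a b : V -> nat).
Hypotheses (a_inj : injective a) (b_inj : injective b).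
Hypothesis adjE : forall x y,
  adj G x y = ((a x < a y) && (b y < b x) || (a y < a x) && (b x < b y))%N.

(** Each edge is charged to its endpoint of smaller label, so the classes [C] of a partition share
    out all edges. *)
Definition lower_rel (C : {set V}) : rel V :=
  fun x y => adj G x y && ((if a x < a y then x else y)%N \in C).

Lemma lower_rel_sym C : symmetric (lower_rel C).
Proof.
move=> x y; rewrite /lower_rel adj_sym.
by case: (ltngtP (a x) (a y)) => // /a_inj->.
Qed.

Lemma lower_rel_irr C : irreflexive (lower_rel C).
Proof. by move=> x; rewrite /lower_rel adj_irr. Qed.

Definition lower C := SGraph (lower_rel_sym C) (lower_rel_irr C).

Lemma lower_threshold (R : realType) (C : {set V}) :
  (forall x y, x \in C -> y \in C -> x != y -> adj G x y) ->
  threshold_graph R (lower C).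
Proof.
move=> clC.
(* Along the clique [C], [b] falls as [a] grows, so each [D z] is an initial segment of [C]: it ends
   at [z] if [z] is in [C], and otherwise is the neighbourhood of [z] in [lower C]. Initial segments
   are nested, so their sizes serve as ranks. *)
pose D z := [set c in C | (a c <= a z)%N && (b z <= b c)%N].
have adjC x y : x \in C -> y \notin C ->
    lower_rel C x y = ((a x < a y) && (b y < b x))%N.
  move=> xC yC; rewrite /lower_rel adjE; case: ltngtP => _ /=.
  - by rewrite orbF xC andbT.
  - by rewrite (negbTE yC) andbF.
  - by [].
apply: (@nested_split_threshold _ _ _ C (fun z => #|D z|)) => x y.
- by move=> xC yC xy /=; rewrite /lower_rel clC //=; case: ifP.
- move=> xC yC; rewrite /= adjC //; apply/idP/idP => [/andP[axy byx]|].
    apply/subset_leq_card/subsetP => c; rewrite !inE => /and3P[-> ca cb] /=.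
    by rewrite (leq_trans ca (ltnW axy)) (leq_trans (ltnW byx) cb).
  apply: contraLR => nxy; rewrite -ltnNge; apply/proper_card/properP; split.
    apply/subsetP => c; rewrite !inE => /and3P[cC ca cb]; rewrite cC /=.
    have ncy : c != y by apply: contraNneq yC => <-.
    have [<-|ncx] := eqVneq c x; first by rewrite !leqnn.
    have := clC _ _ cC xC ncx; rewrite adjE; move: nxy; lia.
  exists x; first by rewrite !inE xC !leqnn.
  rewrite !inE xC /=; apply: contra nxy => /andP[axy byx].
  have nxy : x != y by apply: contraNneq yC => <-.
  have nb : b x != b y by rewrite (inj_eq b_inj).
  have na : a x != a y by rewrite (inj_eq a_inj).
  by lia.
- move=> xC yC; rewrite /= /lower_rel.
  by case: ifP => _; rewrite (negbTE xC, negbTE yC) andbF.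
Qed.

Definition stableb (U : {set V}) :=
  [forall x in U, [forall y in U, ~~ adj G x y]].

Lemma stableP U : reflect (stable G U) (stableb U).
Proof.
apply: (iffP forall_inP) => [st x y xU yU|st x xU].
  by have /forall_inP := st x xU; apply.
by apply/forall_inP => y yU; apply: st.
Qed.

Definition below x := [set y | (a y < a x)%N && (b y < b x)%N].

(** Stable sets are chains, and [x] itself is not counted, so heights start at 0. *)
Definition height x := (\max_(U | stableb U && (U \subset below x)) #|U|)%N.

Lemma height_witness x : exists U, [/\ stable G (x |: U), x \notin U,
  U \subset below x & height x = #|U|].
Proof.
have st0 : stableb set0 && (set0 \subset below x).
  by rewrite sub0set andbT; apply/stableP => y z; rewrite inE.
have := @eq_bigmax_cond _ [pred U | stableb U && (U \subset below x)]
  (fun U : {set V} => #|U|) _.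
case; first by apply/card_gt0P; exists set0.
move=> U /andP[/stableP stU sU] hU; exists U; split=> //.
- have nadj y : y \in U -> ~~ adj G x y.
    by move=> /(subsetP sU); rewrite inE adjE; lia.
  move=> y z /setU1P[->|yU] /setU1P[->|zU]; rewrite ?adj_irr //.
  + exact: nadj.
  + by rewrite adj_sym; apply: nadj.
  + exact: stU.
- by apply/negP => /(subsetP sU); rewrite inE ltnn.
Qed.

(** A longest chain below [x], extended by [x], is a chain below [y]. *)
Lemma height_lt x y : (a x < a y)%N -> (b x < b y)%N -> (height x < height y)%N.
Proof.
move=> axy bxy; have [U [/stableP stU xU sU ->]] := height_witness x.
have <- : #|x |: U| = #|U|.+1 by rewrite cardsU1 xU.
rewrite /height (leq_bigmax_cond (F := fun U : {set V} => #|U|)) // stU /=.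
apply/subsetP => z /setU1P[->|/(subsetP sU)]; rewrite !inE ?axy //.
by lia.
Qed.

Lemma threshold_dim_max_stable (R : realType) m :
  (forall U, stable G U -> (#|U| <= m)%N) -> (threshold_dim R G <= m)%N.
Proof.
move=> maxm; apply: threshold_dim_le.
have hm x : (height x < m)%N.
  have [U [stU xU _ ->]] := height_witness x.
  by have := maxm _ stU; rewrite cardsU1 xU.
exists (fun i : 'I_m => lower [set x | height x == i]); split=> [i|x y].
  (* Vertices of equal height are incomparable by [height_lt], hence adjacent. *)
  apply: lower_threshold => x y; rewrite !inE => /eqP hx /eqP hy nxy.
  have nb : b x != b y by rewrite (inj_eq b_inj).
  have na : a x != a y by rewrite (inj_eq a_inj).
  have := @height_lt x y; have := @height_lt y x.
  by rewrite hx hy ltnn adjE; lia.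
split=> [xy|[i /andP[]//]].
by exists (Ordinal (hm (if a x < a y then x else y)%N));
  rewrite /= /lower_rel xy inE /=.
Qed.

Lemma threshold_dim_half (R : realType) : (threshold_dim R G * 2 <= #|V|)%N.
Proof.
have st0 : stableb set0 by apply/stableP => x y; rewrite inE.
case: (@arg_maxnP _ set0 stableb (fun U : {set V} => #|U|) st0) => S.
move=> /stableP stS maxS.
have := threshold_dim_stable R stS.
have : (threshold_dim R G <= #|S|)%N.
  by apply: threshold_dim_max_stable => U /stableP /maxS.
(* As [#|S| <= #|V|], the subtraction is not truncated and the two bounds add up to [#|V|]. *)
have := max_card (mem S); lia.
Qed.

End SubGraphs.

(** Label and position are pulled back along the isomorphism; a negative product means differences
    of opposite signs. *)
Lemma permutation_graph_coords (V : finType) (G : sgraph V) :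
  permutation_graph G -> exists a b : V -> nat,
    [/\ injective a, injective b & forall x y, adj G x y =
      ((a x < a y) && (b y < b x) || (a y < a x) && (b x < b y))%N].
Proof.
case=> n [s [f /bij_inj f_inj fE]].
exists (fun x => val (f x)), (fun x => val ((s^-1)%g (f x))); split.
- by move=> x y /val_inj /f_inj.
- by move=> x y /val_inj /perm_inj /f_inj.
move=> x y; rewrite fE /= /inversion_rel.
set i : nat := f x; set j : nat := f y.
set k : nat := (s^-1)%g (f x); set l : nat := (s^-1)%g (f y).
apply/idP/idP; last by case/orP => /andP[]; nia.
by case: (ltngtP i j) => ij; case: (ltngtP k l) => kl //=; nia.
Qed.

Theorem theorem5 (R : realType) (n : nat) (V : finType) (G : sgraph V)
    (cardV : #|V| = n) (permG : permutation_graph G) :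
  (threshold_dim R G)%:R <= n%:R / 2 :> R.
Proof.
have [a [b [a_inj b_inj adjE]]] := permutation_graph_coords permG.
rewrite ler_pdivlMr ?ltr0n // -natrM ler_nat -cardV.
exact: threshold_dim_half adjE R.
Qed.
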